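(* Let $K$ be a locally compact Hausdorff topological space which is not $\sigma$-compact and in which every countable family of compact sets is contained in some compact set. Consider $C_0(K)$ as a Hilbert $C^*$-module over itself with inner product $\langle a,b\rangle=a^*b$, whose multiplier module is $C_b(K)$. Then the unit ball of $C_0(K)$ (and hence the image of the unit ball under the identity operator $\mathrm{Id}:C_0(K)\to C_0(K)$) is totally bounded with respect to the seminorm $\nu_{X,\Phi}$ for every $(C_b(K),C_0(K))$-admissible system $X$ and every sequence $\Phi$ of states on $C_0(K)$. In other words, it is $(C_b(K),C_0(K))$-totally bounded.
   Context: $C_0(K)$ is the $C^*$-algebra of continuous complex-valued functions on $K$ vanishing at infinity, and $C_b(K)$ is the $C^*$-algebra of all bounded continuous complex-valued functions on $K$; both carry the sup norm. ''Every countable family of compact sets is contained in some compact set'' means that for any compact $K_1,K_2,\dots\subset K$ there is a compact $K'\subset K$ with $\bigcup_n K_n\subset K'$. For $x\in C_0(K)$ and $y\in C_b(K)$ put $\langle x,y\rangle=\bar x y\in C_0(K)$ and $\langle y,x\rangle=\bar y x\in C_0(K)$. Admissible system: a $(C_b(K),C_0(K))$-admissible system (outer admissible system for $C_0(K)$) is a countable system $X=\{x_i\}$ of elements of $C_b(K)$ such that (1) for each $x\in C_0(K)$ the series $\sum_i\langle x,x_i\rangle\langle x_i,x\rangle$ converges in norm; (2) its sum satisfies $\sum_i\langle x,x_i\rangle\langle x_i,x\rangle\le\langle x,x\rangle$ for each $x\in C_0(K)$; (3) $\|x_i\|\le 1$ for all $i$. Seminorm: given such $X=\{x_i\}$ and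 a countable collection $\Phi=\{\varphi_1,\varphi_2,\dots\}$ of states (positive linear functionals of norm $1$) on $C_0(K)$, define for $x\in C_0(K)$ $$\nu_{X,\Phi}(x)^2:=\sup_k\sum_{i=k}^\infty|\varphi_k(\langle x,x_i\rangle)|^2,\qquad d_{X,\Phi}(x,y):=\nu_{X,\Phi}(x-y).$$ Total boundedness: a set $Y\subseteq C_0(K)$ is totally bounded with respect to $\nu_{X,\Phi}$ if for every $\varepsilon>0$ there are finitely many $y_1,\dots,y_n\in Y$ such that the sets $\{y\in Y: d_{X,\Phi}(y_i,y)<\varepsilon\}$, $i=1,\dots,n$, cover $Y$. It is $(C_b(K),C_0(K))$-totally bounded if this holds for every pair $(X,\Phi)$ consisting of a $(C_b(K),C_0(K))$-admissible system $X=\{x_i\}$ of elements of $C_b(K)$ and a countable collection $\Phi=\{\varphi_1,\varphi_2,\dots\}$ of states on $C_0(K)$. *)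

(* Defs.v *)
From HB Require Import structures.
From mathcomp Require Import all_boot all_order all_algebra.
From mathcomp Require Import all_classical all_reals all_analysis.
From mathcomp Require Import complex.

Set Implicit Arguments.
Unset Strict Implicit.
Unset Printing Implicit Defensive.

Import Order.TTheory GRing.Theory Num.Theory.
Import numFieldNormedType.Exports.
Import Normc.

Local Open Scope classical_set_scope.
Local Open Scope ring_scope.
Local Open Scope complex_scope.

(* The usual topology of the complex plane R[i], as a normed module over
   itself; the norm `|z| is R[i]-valued and equal to (normc z)%:C. *)
HB.instance Definition _ (R : rcfType) := NormedModule.copy R[i] R[i]^o.

Section SigmaCompact.
Variable K : topologicalType.

Definition sigma_compact : Prop :=
  exists A : nat -> set K,
    (forall n, compact (A n)) /\ \bigcup_n A n = [set: K].

Definition countable_compacts_bounded : Prop :=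
  forall A : nat -> set K, (forall n, compact (A n)) ->
    exists2 B : set K, compact B & \bigcup_n A n `<=` B.

End SigmaCompact.

Section ComplexNorm.
Variable R : realType.
Implicit Types z : R[i].

Lemma normc_ge0 z : 0 <= normc z.
Proof. by case: z => a b; exact: sqrtr_ge0. Qed.

Lemma normc_conj z : normc z^* = normc z.
Proof. by case: z => a b; rewrite /= sqrrN. Qed.

Lemma continuous_conjc : continuous (fun z : R[i] => z^*).
Proof.
move=> z A /nbhs_ballP[e /= e0 eA]; apply/nbhs_ballP; exists e => //= w.
rewrite -!ball_normE /= => zw; apply: eA.
by rewrite -ball_normE /= -rmorphB normcJ.
Qed.

End ComplexNorm.

Section BoundedContinuous.
Variables (K : topologicalType) (R : realType).

Definition Cb_pred : {pred K -> R[i]} :=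
  [pred f : K -> R[i] | `[< continuous f /\ bounded_fun f >]].

Lemma Cb_predP (f : K -> R[i]) :
  reflect (continuous f /\ exists M : R, forall t, normc (f t) <= M)
          (f \in Cb_pred).
Proof.
apply: (iffP (asboolP _)) => -[cf bf]; split=> //.
  have [M _ HM] := ex_strict_bound_gt0 bf.
  exists (complex.Re M) => t; have := HM t I.
  by rewrite /= ltcE /= => /andP[_ /ltW].
case: bf => M HM; exists M%:C; split; first by apply/complex_realP; exists M.
by move=> z Mz t _ /=; apply/ltW/(le_lt_trans _ Mz); rewrite /= lecR.
Qed.

Lemma Cb_pred_submod_closed : submod_closed Cb_pred.
Proof.
split=> [|a f g /Cb_predP[cf [M HM]] /Cb_predP[cg [N HN]]]; apply/Cb_predP.
  split; first exact: cst_continuous.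
  by exists 0 => t; rewrite normc0.
split.
  move=> t; apply: (@cvgD R[i] R[i] K); last exact: cg.
  by apply: (@cvgZl_tmp R[i] R[i] K); exact: cf.
exists (normc a * M + N) => t.
apply: le_trans (le_normcD _ _) (lerD _ (HN t)).
by rewrite normcM ler_wpM2l // normc_ge0.
Qed.

HB.instance Definition _ :=
  GRing.isSubmodClosed.Build _ _ Cb_pred Cb_pred_submod_closed.

Record Cb := MkCb { Cb_fun :> K -> R[i]; Cb_funP : Cb_fun \in Cb_pred }.

HB.instance Definition _ := [isSub for Cb_fun].
HB.instance Definition _ := [Choice of Cb by <:].
HB.instance Definition _ := [SubChoice_isSubLmodule of Cb by <:].

Implicit Types f g : Cb.

Definition supnorm f : R := sup [set normc (f t) | t in [set: K]].

Lemma normc_le_supnorm f t : normc (f t) <= supnorm f.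
Proof.
have /Cb_predP[_ [M HM]] := Cb_funP f.
by apply: ub_le_sup; [exists M => _ [s _ <-]; exact: HM | exists t].
Qed.

Lemma supnorm_ge0 f : 0 <= supnorm f.
Proof.
have [[t0 _]|K0] := pselect (exists t : K, True).
  exact: le_trans (normc_ge0 _) (normc_le_supnorm f t0).
rewrite /supnorm (_ : [set _ | _ in _] = set0) ?sup0 //.
by apply/seteqP; split=> // r [t _ _]; apply: K0; exists t.
Qed.

Lemma supnorm_le f (M : R) :
  0 <= M -> (forall t, normc (f t) <= M) -> supnorm f <= M.
Proof.
move=> M0 HM; have [[t0 _]|K0] := pselect (exists t : K, True).
  by apply: ge_sup; [exists (normc (f t0)), t0 | move=> _ [t _ <-]; exact: HM].
rewrite /supnorm (_ : [set _ | _ in _] = set0) ?sup0 //.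
by apply/seteqP; split=> // r [t _ _]; apply: K0; exists t.
Qed.

Lemma CbDE f g t : (f + g) t = f t + g t. Proof. by []. Qed.
Lemma CbZE (a : R[i]) f t : (a *: f) t = a * f t. Proof. by []. Qed.
Lemma Cb0E t : (0 : Cb) t = 0. Proof. by []. Qed.

Definition Cb_norm f : R[i] := (supnorm f)%:C.

Lemma Cb_normD f g : Cb_norm (f + g) <= Cb_norm f + Cb_norm g.
Proof.
rewrite -rmorphD lecR; apply: supnorm_le => [|t].
  by rewrite addr_ge0 ?supnorm_ge0.
rewrite CbDE; apply: le_trans (le_normcD _ _) (lerD _ _);
  exact: normc_le_supnorm.
Qed.

Lemma Cb_normZ (a : R[i]) f : Cb_norm (a *: f) = `|a| * Cb_norm f.
Proof.
rewrite -[`|a|]/((normc a)%:C) -rmorphM; congr (_%:C).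
have le_Z b g : supnorm (b *: g) <= normc b * supnorm g.
  apply: supnorm_le => [|t]; first by rewrite mulr_ge0 ?normc_ge0 ?supnorm_ge0.
  by rewrite CbZE normcM ler_wpM2l ?normc_ge0 ?normc_le_supnorm.
apply/eqP; rewrite eq_le le_Z /=.
have [->|a0] := eqVneq a 0; first by rewrite normc0 mul0r supnorm_ge0.
have na0 : 0 < normc a.
  by rewrite lt_def normc_ge0 andbT; apply: contra_neq a0 => /eq0_normc.
rewrite -ler_pdivlMl // -normcV; apply: le_trans (le_Z _ _).
by rewrite scalerA mulVf // scale1r.
Qed.

Lemma Cb_norm0_eq0 f : Cb_norm f = 0 -> f = 0.
Proof.
move=> [f0]; apply/val_inj/funext => t.
apply: eq0_normc; apply/eqP; rewrite eq_le normc_ge0 andbT.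
by rewrite -f0 normc_le_supnorm.
Qed.

HB.instance Definition _ :=
  Lmodule_isNormed.Build R[i] Cb Cb_normD Cb_normZ Cb_norm0_eq0.

(* a^* b, computed pointwise in the C*-algebra Cb *)
Lemma Cb_inner_subproof f g : (fun t => (f t)^* * g t) \in Cb_pred.
Proof.
have /Cb_predP[cf [M HM]] := Cb_funP f.
have /Cb_predP[cg [N HN]] := Cb_funP g.
apply/Cb_predP; split.
  move=> t; apply: (@cvgM R[i] K); last exact: cg.
  by apply: (@continuous_comp _ _ _ f) (cf t) _; exact: continuous_conjc.
exists (M * N) => t; rewrite normcM normc_conj.
by apply: ler_pM; rewrite ?normc_ge0.
Qed.

Definition Cb_inner f g : Cb := MkCb (Cb_inner_subproof f g).

Lemma Cb_mul_subproof f g : (fun t => f t * g t) \in Cb_pred.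
Proof.
have /Cb_predP[cf [M HM]] := Cb_funP f.
have /Cb_predP[cg [N HN]] := Cb_funP g.
apply/Cb_predP; split.
  by move=> t; apply: (@cvgM R[i] K); [exact: cf | exact: cg].
by exists (M * N) => t; rewrite normcM; apply: ler_pM; rewrite ?normc_ge0.
Qed.

Definition Cb_mul f g : Cb := MkCb (Cb_mul_subproof f g).

End BoundedContinuous.

Section VanishingAtInfinity.
Variables (K : topologicalType) (R : realType).

Definition vanishes_at_infinity (f : K -> R[i]) : Prop :=
  forall e : R[i], 0 < e ->
    exists2 A : set K, compact A & forall t, ~ A t -> `|f t| < e.

Definition C0_pred : {pred Cb K R} :=
  [pred f : Cb K R | `[< vanishes_at_infinity f >]].

Lemma C0_pred_submod_closed : submod_closed C0_pred.
Proof.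
split=> [|a f g /asboolP f0 /asboolP g0]; apply/asboolP => e e0.
  by exists set0 => [|t _]; [exact: compact0 | rewrite normr0].
have e2 : 0 < e / 2 by rewrite divr_gt0.
have a1 : 0 < `|a| + 1 by rewrite ltr_wpDl.
have [A cA fA] := f0 _ (divr_gt0 e2 a1).
have [B cB gB] := g0 _ e2.
exists (A `|` B); first exact: compactU.
move=> t /not_orP[At Bt].
rewrite CbDE CbZE (splitr e); apply: le_lt_trans (ler_normD _ _) _.
apply: ler_ltD (gB _ Bt); rewrite normrM.
apply: le_trans (_ : (`|a| + 1) * `|f t| <= _).
  by rewrite ler_wpM2r // lerDl.
by rewrite mulrC -ler_pdivlMr // ltW // fA.
Qed.

HB.instance Definition _ :=
  GRing.isSubmodClosed.Build _ _ C0_pred C0_pred_submod_closed.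

(* Boundedness is no restriction here: see C0_of below. *)
Record C0 := MkC0 { C0_Cb :> Cb K R; C0_CbP : C0_Cb \in C0_pred }.

HB.instance Definition _ := [isSub for C0_Cb].
HB.instance Definition _ := [Choice of C0 by <:].
HB.instance Definition _ := [SubChoice_isSubLmodule of C0 by <:].

Implicit Types (x y : C0) (b : Cb K R).

Definition C0_norm x : R[i] := `|C0_Cb x|.

Lemma C0_normD x y : C0_norm (x + y) <= C0_norm x + C0_norm y.
Proof. exact: ler_normD. Qed.

Lemma C0_normZ (a : R[i]) x : C0_norm (a *: x) = `|a| * C0_norm x.
Proof. exact: normrZ. Qed.

Lemma C0_norm0_eq0 x : C0_norm x = 0 -> x = 0.
Proof. by move=> /normr0_eq0 x0; apply: val_inj. Qed.

HB.instance Definition _ :=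
  Lmodule_isNormed.Build R[i] C0 C0_normD C0_normZ C0_norm0_eq0.

Lemma vanishes_dominated (M : R) (f g : K -> R[i]) :
  (forall t, normc (g t) <= M * normc (f t)) ->
  vanishes_at_infinity f -> vanishes_at_infinity g.
Proof.
move=> gMf f0 e e0.
have M1 : 0 < `|M| + 1 by rewrite ltr_wpDl.
have M1C : 0 < (`|M| + 1)%:C by rewrite ltcR.
have [A cA fA] := f0 _ (divr_gt0 e0 M1C).
exists A => // t /fA; rewrite ltr_pdivlMr // => /(le_lt_trans _); apply.
rewrite -[`|g t|]/((normc (g t))%:C) -[`|f t|]/((normc (f t))%:C).
rewrite -rmorphM lecR mulrC (le_trans (gMf t)) // ler_wpM2r ?normc_ge0 //.
by rewrite (le_trans (ler_norm _)) // lerDl.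
Qed.

Lemma C0_vanishes x : vanishes_at_infinity x.
Proof. exact: (asboolP _ (C0_CbP x)). Qed.

Lemma C0_inner_l_subproof x b : Cb_inner x b \in C0_pred.
Proof.
apply/asboolP; apply: (@vanishes_dominated (supnorm b)) (C0_vanishes x) => t.
by rewrite /= normcM normc_conj mulrC ler_wpM2r ?normc_ge0 ?normc_le_supnorm.
Qed.

Lemma C0_inner_r_subproof b x : Cb_inner b x \in C0_pred.
Proof.
apply/asboolP; apply: (@vanishes_dominated (supnorm b)) (C0_vanishes x) => t.
by rewrite /= normcM normc_conj ler_wpM2r ?normc_ge0 ?normc_le_supnorm.
Qed.

Lemma C0_mul_subproof x y : Cb_mul x y \in C0_pred.
Proof.
apply/asboolP; apply: (@vanishes_dominated (supnorm x)) (C0_vanishes y) => t.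
by rewrite /= normcM ler_wpM2r ?normc_ge0 ?normc_le_supnorm.
Qed.

(* <x, b> and <b, x>; both pairings are conjugate-linear on the left *)
Definition C0_inner_l x b : C0 := MkC0 (C0_inner_l_subproof x b).
Definition C0_inner_r b x : C0 := MkC0 (C0_inner_r_subproof b x).

Definition C0_mul x y : C0 := MkC0 (C0_mul_subproof x y).

(* The order of R[i] makes f t <= g t include that g t - f t is real. *)
Definition C0_le x y : Prop := forall t, x t <= y t.

Lemma vanishes_Cb (f : K -> R[i]) :
  continuous f -> vanishes_at_infinity f -> f \in @Cb_pred K R.
Proof.
move=> cf f0; have [A cA fA] := f0 1 ltr01.
have cn : continuous (fun t => normc (f t) : R).
  move=> t; apply/cvgrPdist_lt => e e0.
  have eC : 0 < e%:C by rewrite ltcR.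
  have := @cvgr_dist_lt R[i] R[i] K (nbhs t) (nbhs_filter t) f (f t) (cf t) _ eC.
  apply: filterS => s.
  rewrite -[`|f t - f s|]/((normc (f t - f s))%:C) ltcR; apply: le_lt_trans.
  rewrite ler_norml lerNl opprB !lerBlDr; apply/andP; split.
    by rewrite -(opprB (f s)) normcN -{1}(subrK (f t) (f s)) le_normcD.
  by rewrite -{1}(subrK (f s) (f t)) le_normcD.
have /compact_bounded [M [_ HM]] :=
  continuous_compact (continuous_subspaceT cn) cA.
apply/Cb_predP; split=> //; exists (Num.max 1 (M + 1)) => t.
have [At|/fA] := pselect (A t).
  have /= := HM (M + 1); rewrite ltrDl => /(_ ltr01 (normc (f t))) H.
  by rewrite le_max (le_trans (ler_norm _) (H _)) ?orbT //; exists t.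
by rewrite -[`|f t|]/((normc (f t))%:C) ltcR le_max => /ltW ->.
Qed.

(* Every continuous function vanishing at infinity is an element of C0. *)
Definition C0_of (f : K -> R[i]) (cf : continuous f)
  (f0 : vanishes_at_infinity f) : C0 :=
  @MkC0 (MkCb (vanishes_Cb cf f0)) (asboolT f0).

End VanishingAtInfinity.

Section TotalBoundedness.
Variables (K : topologicalType) (R : realType).
Local Notation A := (C0 K R).
Local Notation M := (Cb K R).

Implicit Types (X : nat -> M) (Phi : nat -> {scalar A}).

Definition unit_ball : set A := [set x | `|x| <= 1].

(* <x, x_i><x_i, x> *)
Definition frame_term X (x : A) (i : nat) : A :=
  C0_mul (C0_inner_l x (X i)) (C0_inner_r (X i) x).

(* A finite system is encoded by a sequence that is eventually 0; likewise, in
   nu below, finitely many states by repeating the last one. *)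
Definition admissible_system X : Prop :=
  [/\ forall x : A, cvgn (series (frame_term X x)),
      forall x : A, C0_le (limn (series (frame_term X x))) (C0_inner_l x x)
    & forall i, `|X i| <= 1].

(* \bar R-valued, so that an unbounded functional has norm +oo *)
Definition functional_norm (phi : {scalar A}) : \bar R :=
  ereal_sup [set (normc (phi x))%:E | x in unit_ball].

Definition is_state (phi : {scalar A}) : Prop :=
  (forall x : A, C0_le 0 x -> 0 <= phi x) /\ functional_norm phi = 1%E.

(* Indices start at 0, for X and Phi alike. *)
Definition nu_sqr X Phi (x : A) : \bar R :=
  ereal_sup [set (\sum_(k <= i <oo)
    (normc (Phi k (C0_inner_l x (X i))) ^+ 2)%:E)%E | k in [set: nat]].

Definition nu X Phi (x : A) : \bar R := sqrte (nu_sqr X Phi x).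

Definition nu_dist X Phi (x y : A) : \bar R := nu X Phi (x - y).

Definition nu_totally_bounded X Phi (Y : set A) : Prop :=
  forall e : R, 0 < e ->
    exists F : set A, [/\ finite_set F, F `<=` Y &
      Y `<=` \bigcup_(z in F) [set y | Y y /\ (nu_dist X Phi z y < e%:E)%E]].

Definition outer_totally_bounded (Y : set A) : Prop :=
  forall X Phi, admissible_system X -> (forall k, is_state (Phi k)) ->
    nu_totally_bounded X Phi Y.

End TotalBoundedness.

Arguments unit_ball : clear implicits.

(* Main.v *)
Require Import Defs.
From HB Require Import structures.
From mathcomp Require Import all_boot all_order all_algebra.
From mathcomp Require Import all_classical all_reals all_analysis.
From mathcomp Require Import complex.
From mathcomp Require Import ring lra.

Set Implicit Arguments.
Unset Strict Implicit.
Unset Printing Implicit Defensive.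

Import Order.TTheory GRing.Theory Num.Theory.
Import numFieldNormedType.Exports.
Import Normc.

Local Open Scope classical_set_scope.
Local Open Scope ring_scope.
Local Open Scope complex_scope.

(** The hypothesis on compact sets lets a single compact set B serve all the
states at once.  A function vanishing at infinity is zero off the compact set
containing all its superlevel sets, so the functions on which the states
almost attain their norms, countably many, are all supported in one compact B
([states_carried_by_compact]).  A functional of norm 1 whose norm is attained,
up to any d > 0, on functions supported in B must kill every function
vanishing on B ([carried_by_support]).

Choose e in C_0(K) equal to 1 on B ([C0_urysohn]).  Then every state phi of
the family satisfies phi(f) = phi(e f), so that the sum over m <= i < n of
|phi(<y, x_i>)|^2 is at most |y|^2 times the norm of the same segment of the
series of <e, x_i><x_i, e> ([carried_tail_le]).  By admissibility the series
for this one e is Cauchy ([frame_tail_small]), so the tails are small uniformly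
in the state and in y of norm at most 2.  For some N,
what remains of the seminorm up to a small error is the finite family of
coordinates phi_k(<y, x_i>) with k, i < N.  These are bounded on the unit
ball, and a finite family of bounded coordinates admits finite nets
([unit_ball_coordinates_net]). *)

(** * Finite nets for bounded coordinates *)

(** Two points are close as soon as all their coordinates fall into the same
cells of a grid of mesh [d]; there are finitely many cells, and one point of
[Y] is kept for each cell met by [Y]. *)
Lemma finite_net (R : realType) (I : finType) (T : Type) (Y : set T)
    (g : I -> T -> R) (d : R) : 0 < d -> Y !=set0 ->
    (forall i y, Y y -> `|g i y| <= 1) ->
  exists F : set T, [/\ finite_set F, F `<=` Y &
    forall y, Y y -> exists2 z, F z & forall i, `|g i y - g i z| < d].
Proof.
move=> d0 [y0 Yy0] g1.
(* Shifting by 1 makes coordinates of modulus at most 1 nonnegative. *)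
pose cell i y := Num.truncn ((g i y + 1) / d).
have cell_lt i y : Y y -> (cell i y < (Num.truncn (2 / d)).+1)%N.
  move=> /(g1 i); rewrite ler_norml => /andP[_ giy].
  by rewrite ltnS; apply: le_truncn; rewrite ler_pM2r ?invr_gt0 //; lra.
pose code y : {ffun I -> 'I_(Num.truncn (2 / d)).+1} :=
  [ffun i => inord (cell i y)].
(* Cells that do not meet [Y] are represented by [y0]. *)
have /choice[rep repP] : forall c, exists z,
    Y z /\ ((exists2 y, Y y & code y = c) -> code z = c).
  move=> c; have [[y Yy cy]|nc] := pselect (exists2 y, Y y & code y = c).
    by exists y.
  by exists y0; split.
exists (range rep); split.
- exact/finite_image/finite_finset.
- by move=> _ [c _ <-]; have [] := repP c.
move=> y Yy; exists (rep (code y)); first by exists (code y).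
move=> i; have [Yz cz] := repP (code y).
have : cell i (rep (code y)) = cell i y.
  move: (cz (ex_intro2 _ _ y Yy erefl)) => /ffunP/(_ i).
  by rewrite !ffunE => /(congr1 val); rewrite /= !inordK ?cell_lt.
have bnd z : Y z -> (cell i z)%:R * d <= g i z + 1 < (cell i z)%:R * d + d.
  move=> /(g1 i); rewrite ler_norml => /andP[gz _].
  have : 0 <= (g i z + 1) / d by rewrite divr_ge0 ?(ltW d0) //; lra.
  move=> /truncn_itv; rewrite ler_pdivlMr // ltr_pdivrMr //.
  by rewrite -natr1 [(_ + 1) * d]mulrDl mul1r.
have /andP[ly uy] := bnd _ Yy; have /andP[lz uz] := bnd _ Yz.
move=> cE; rewrite cE in lz uz.
by rewrite ltr_norml; apply/andP; split; lra.
Qed.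

(** * Complex numbers *)

Lemma complex_gt0 (R : rcfType) (e : R[i]) :
  0 < e -> exists2 r : R, 0 < r & e = r%:C.
Proof.
by case: e => a b; rewrite ltcE /= => /andP[/eqP -> a0]; exists a.
Qed.

Lemma normc_real (R : rcfType) (r : R) : normc r%:C = `|r|.
Proof. by rewrite /= expr0n /= addr0 sqrtr_sqr. Qed.

Lemma phase (R : realType) (z : R[i]) :
  exists2 a : R[i], normc a = 1 & a * z = (normc z)%:C.
Proof.
have [->|z0] := eqVneq z 0; first by exists 1; rewrite ?normc1 // mulr0 normc0.
have nz0 : normc z != 0 by apply: contra_neq z0 => /eq0_normc.
exists ((normc z)%:C / z); last by rewrite divfK.
by rewrite normcM normcV normc_real ger0_norm ?normc_ge0 // divff.
Qed.

Lemma mulcJ_normc (R : rcfType) (z : R[i]) : z^* * z = (normc z ^+ 2)%:C.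
Proof.
case: z => a b; apply/eqP; rewrite /= sqr_sqrtr ?addr_ge0 ?sqr_ge0 //.
by rewrite eq_complex /=; apply/andP; split; apply/eqP; ring.
Qed.

Lemma ler_normc_sqr (R : realType) (z : R[i]) (d : R) :
    `|complex.Re z| < d -> `|complex.Im z| < d ->
  normc z ^+ 2 <= 2 * d ^+ 2.
Proof.
case: z => a b /= ad bd; rewrite sqr_sqrtr ?addr_ge0 ?sqr_ge0 //.
have d0 : 0 <= d by exact: le_trans (ltW ad).
by rewrite mulr_natl mulr2n; apply: lerD; rewrite -real_normK ?num_real //
  ler_sqr ?nnegrE // ltW.
Qed.

(** * A function of C_0(K) equal to 1 on a compact set *)

Section UrysohnAtInfinity.
Variables (K : topologicalType) (R : realType).
Hypotheses (lcK : locally_compact [set: K]) (hdK : hausdorff_space K).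

Lemma continuous_real_complex (f : K -> R) :
  continuous f -> continuous (fun t => (f t)%:C : R[i]).
Proof.
move=> cf t; apply/(@cvgrPdist_lt R[i] R[i]) => _ /complex_gt0[e e0 ->].
have /cvgrPdist_lt/(_ _ e0) := cf t.
apply: filterS => s fts; rewrite -rmorphB.
by rewrite -[`|_|]/((normc (f t - f s)%:C)%:C) normc_real ltcR.
Qed.

(** The compact set and the point at infinity are disjoint closed sets of the
one-point compactification, which is compact Hausdorff and hence normal;
continuity at infinity of a separating function that is 0 there says precisely
that it vanishes at infinity on [K]. *)
Lemma C0_urysohn (B : set K) : compact B ->
  exists e : C0 K R, forall t, B t -> e t = 1.
Proof.
move=> cB; pose opc := one_point_compactification K.
have hopc : hausdorff_space opc by exact: one_point_compactification_hausdorff.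
have nopc : normal_space opc.
  exact: compact_normal hopc one_point_compactification_compact.
have cSB : closed (Some @` B : set opc).
  apply: compact_closed => //; apply: continuous_compact => //.
  exact/continuous_subspaceT/one_point_compactification_some_continuous.
have cinf : closed ([set None] : set opc).
  by apply: compact_closed => //; exact: compact_set1.
have dis : [set None] `&` (Some @` B) = set0 :> set opc.
  by apply/seteqP; split=> // z [-> [? _]].
have [f [cf f0 f1 _]] := @urysohn_ext_itv _ R nopc _ _ 0 1 cinf cSB dis ltr01.
have cg : continuous (fun t => (f (Some t))%:C : R[i]).
  apply: continuous_real_complex => t.
  apply: (@continuous_comp _ _ _ (Some : K -> opc)) _ (cf _).
  exact: one_point_compactification_some_continuous.
have g0 : vanishes_at_infinity (fun t => (f (Some t))%:C).
  move=> _ /complex_gt0[e e0 ->].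
  have /cvgrPdist_lt/(_ _ e0)[A [cA _] fA] := cf None.
  exists A => // t At; have /fA/= : (Some @` (~` A) `|` [set None]) (Some t).
    by left; exists t.
  rewrite (f0 (f None)) //; last by exists None.
  rewrite sub0r normrN.
  by rewrite -[`|_%:C|]/((normc (f (Some t))%:C)%:C) normc_real ltcR.
exists (C0_of cg g0) => t Bt.
by rewrite /= (f1 (f (Some t))) //; exists (Some t) => //; exists t.
Qed.
End UrysohnAtInfinity.


(** * Functionals carried by a compact set *)

Section Functionals.
Variables (K : topologicalType) (R : realType).
Local Notation A := (C0 K R).
Implicit Types (x y f : A) (phi : {scalar A}) (B : set K).

Lemma C0_sumE (I : Type) (r : seq I) (P : pred I) (F : I -> A) t :
  (\sum_(i <- r | P i) F i) t = \sum_(i <- r | P i) F i t.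
Proof. exact: (big_morph (fun x : A => x t)). Qed.

Lemma unit_ballP x : unit_ball K R x <-> forall t, normc (x t) <= 1.
Proof.
rewrite /unit_ball /= -[`|x|]/((supnorm x)%:C) lecR; split=> [x1 t|x1].
  exact: le_trans (normc_le_supnorm _ _) x1.
exact: supnorm_le.
Qed.

Lemma functional_norm1_le phi x : functional_norm phi = 1%E ->
  normc (phi x) <= supnorm x.
Proof.
move=> phi1; have [x0|x0] := eqVneq (supnorm x) 0.
  have -> : x = 0.
    by apply/eqP; rewrite -normr_eq0 -[`|x|]/((supnorm x)%:C) x0.
  by rewrite linear0 normc0 supnorm_ge0.
have s0 : 0 < supnorm x by rewrite lt_def x0 supnorm_ge0.
pose y : A := (supnorm x)^-1%:C *: x.
have yb : unit_ball K R y.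
  apply/unit_ballP => t; rewrite /y /= normcM normc_real.
  by rewrite gtr0_norm ?invr_gt0 // ler_pdivrMl // mulr1 normc_le_supnorm.
have : ((normc (phi y))%:E <= 1)%E.
  by rewrite -phi1; apply: ereal_sup_ubound; exists y.
rewrite lee_fin /y linearZ_LR normcM normc_real gtr0_norm ?invr_gt0 //.
by rewrite ler_pdivrMl // mulr1.
Qed.

(** For positive [phi] and compact [B] this says that the measure representing
[phi] is concentrated on [B]. *)
Definition carried_by phi B := 
  forall f, (forall t, B t -> f t = 0) -> phi f = 0.

(** If [x] lives on [B] and [f] off [B], both bounded by 1, then so is any
combination [a *: x + b *: f] with unimodular [a] and [b]; choosing the phases
well gives [|phi x| + |phi f| <= 1], and [|phi x|] can be taken close to 1. *)
Lemma carried_by_support phi B : functional_norm phi = 1%E ->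
    (forall d, 0 < d -> exists x, [/\ unit_ball K R x,
       forall t, ~ B t -> x t = 0 & 1 - d < normc (phi x)]) ->
  carried_by phi B.
Proof.
move=> phi1 norming f fB.
pose s := supnorm f + 1; have s0 : 0 < s by rewrite ltr_wpDl ?supnorm_ge0.
suff : normc (phi f) <= 0.
  by move=> h; apply/eq0_normc/eqP; rewrite eq_le h normc_ge0.
rewrite leNgt; apply/negP => phif.
have [x [/unit_ballP x1 xB]] := norming _ (divr_gt0 phif s0).
apply/negP; rewrite -leNgt lerBrDr.
have [a a1 ax] := phase (phi x); have [b b1 bf] := phase (phi f).
pose y : A := a *: x + (b * s^-1%:C) *: f.
have -> : normc (phi x) + normc (phi f) / s = normc (phi y).
  rewrite linearD !linearZ_LR ax mulrAC bf -rmorphM -rmorphD normc_real.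
  rewrite ger0_norm // addr_ge0 ?normc_ge0 // mulr_ge0 ?normc_ge0 //.
  by rewrite invr_ge0 ltW.
apply: le_trans (functional_norm1_le _ phi1) _; apply: supnorm_le => // t.
rewrite -[y t]/(a * x t + b * s^-1%:C * f t).
have [/fB ->|/xB ->] := pselect (B t).
  by rewrite mulr0 addr0 normcM a1 mul1r.
rewrite mulr0 add0r !normcM b1 mul1r normc_real gtr0_norm ?invr_gt0 //.
rewrite ler_pdivrMl // mulr1 (le_trans (normc_le_supnorm _ _)) //.
by rewrite /s lerDl.
Qed.

Hypothesis ccK : countable_compacts_bounded K.

(** The compact sets off which [|x| < 1 / (n + 1)] lie in a common one. *)
Lemma C0_compact_support x :
  exists2 B, compact B & forall t, ~ B t -> x t = 0.
Proof.
have vanish n : 0 < (n.+1%:R^-1 : R)%:C :> R[i] by rewrite ltcR.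
have /choice[C CP] : forall n, exists C : set K, compact C /\
    forall t, ~ C t -> `|x t| < (n.+1%:R^-1)%:C.
  by move=> n; have [C cC xC] := C0_vanishes x (vanish n); exists C.
have [B cB CB] := ccK (fun n => (CP n).1).
exists B => // t Bt; apply: eq0_normc; apply/eqP; rewrite eq_le normc_ge0 andbT.
apply/ler_addgt0Pl => e e0; rewrite addr0.
have [n _ ne] := near_infty_natSinv_lt (PosNum e0).
apply: le_trans (ltW (ne n (leqnn n))); rewrite ltW //.
have /(CP n).2 : ~ C n t by move=> Ct; apply: Bt; apply: CB; exists n.
by rewrite -[`|x t|]/((normc (x t))%:C) ltcR.
Qed.

Lemma states_carried_by_compact (Phi : nat -> {scalar A}) :
    (forall k, functional_norm (Phi k) = 1%E) ->
  exists2 B, compact B & forall k, carried_by (Phi k) B.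
Proof.
move=> Phi1.
suff /choice[C CP] : forall k, exists C, compact C /\ carried_by (Phi k) C.
  have [B cB CB] := ccK (fun k => (CP k).1).
  exists B => // k f fB; apply: (CP k).2 => t Ct.
  by apply/fB/CB; exists k.
move=> k.
have /choice[x xP] : forall n, exists x, unit_ball K R x /\
    1 - n.+1%:R^-1 < normc (Phi k x).
  move=> n; have : ((1 - n.+1%:R^-1)%:E < functional_norm (Phi k))%E.
    by rewrite Phi1 lte_fin ltrBlDr ltrDl invr_gt0.
  by move=> /ereal_sup_gt[_ [x xb <-]]; rewrite lte_fin => h; exists x.
have /choice[D DP] : forall n, exists D : set K, compact D /\
    forall t, ~ D t -> x n t = 0.
  by move=> n; have [D cD xD] := C0_compact_support (x n); exists D.
have [C cC DC] := ccK (fun n => (DP n).1).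
exists C; split=> //; apply: carried_by_support => // d d0.
have [n _ nd] := near_infty_natSinv_lt (PosNum d0).
exists (x n); split; first exact: (xP n).1.
  by move=> t Ct; apply: (DP n).2 => Dt; apply: Ct; apply: DC; exists n.
apply: lt_trans (xP n).2; rewrite ltrD2l ltrN2; exact: nd (leqnn n).
Qed.

End Functionals.

(** * Uniform control of the tails *)

Section Tails.
Variables (K : topologicalType) (R : realType).
Local Notation A := (C0 K R).
Variables (X : nat -> Cb K R).

Lemma frame_termE (e : A) i t :
  frame_term X e i t = ((normc (e t) * normc (X i t)) ^+ 2)%:C.
Proof.
transitivity ((normc (e t) ^+ 2)%:C * (normc (X i t) ^+ 2)%:C).
  by rewrite -!mulcJ_normc -[LHS]/((e t)^* * X i t * ((X i t)^* * e t)); ring.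
by rewrite -rmorphM -exprMn.
Qed.

(** Write [c i] for [phi <y, X i>] and [S] for the sum on the left.  Applied to
the sum [w] of the [(c i)^* e <y, X i>], [phi] gives [S], since the factor [e]
is invisible to [phi].  Bounding [|w t|] pointwise by the arithmetic-geometric
mean inequality yields [S <= (S + rhs) / 2]. *)
Lemma carried_tail_le (phi : {scalar A}) (B : set K) (e y : A) (m n : nat) :
    functional_norm phi = 1%E -> carried_by phi B ->
    (forall t, B t -> e t = 1) ->
  \sum_(m <= i < n) normc (phi (C0_inner_l y (X i))) ^+ 2 <=
  supnorm y ^+ 2 * supnorm (\sum_(m <= i < n) frame_term X e i).
Proof.
move=> phi1 phiB eB.
pose c i := phi (C0_inner_l y (X i)).
set S := \sum_(_ <= _ < _) _.
set D := supnorm (\sum_(m <= i < n) frame_term X e i).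
pose w : A := \sum_(m <= i < n) (c i)^* *: C0_mul e (C0_inner_l y (X i)).
have phiw : phi w = S%:C.
  rewrite linear_sum rmorph_sum; apply: eq_bigr => i _.
  rewrite linearZ_LR /= -mulcJ_normc; congr (_ * _).
  apply/eqP; rewrite -subr_eq0 -linearB; apply/eqP/phiB => t Bt.
  by rewrite -[LHS]/(e t * C0_inner_l y (X i) t - C0_inner_l y (X i) t)
     eB // mul1r subrr.
have S0 : 0 <= S by apply: sumr_ge0 => i _; exact: sqr_ge0.
suff : S <= (S + supnorm y ^+ 2 * D) / 2 by lra.
rewrite -[leLHS]ger0_norm // -normc_real -phiw.
apply: le_trans (functional_norm1_le _ phi1) (supnorm_le _ _) => [|t].
  by rewrite divr_ge0 // addr_ge0 // mulr_ge0 ?sqr_ge0 ?supnorm_ge0.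
have wt : normc (w t) <=
    \sum_(m <= i < n) normc (c i) * (supnorm y * (normc (e t) * normc (X i t))).
  rewrite C0_sumE; elim/big_ind2: _ => [|p p' q q' le_p le_q|i _].
  - by rewrite normc0.
  - exact: le_trans (le_normcD _ _) (lerD le_p le_q).
  rewrite (_ : Cb_fun _ t = (c i)^* * (e t * ((y t)^* * X i t))) //.
  rewrite !normcM !normc_conj ler_wpM2l ?normc_ge0 // mulrCA.
  by rewrite ler_wpM2r ?mulr_ge0 ?normc_ge0 ?normc_le_supnorm.
apply: le_trans wt _.
have Dt : \sum_(m <= i < n) (normc (e t) * normc (X i t)) ^+ 2 <= D.
  have := normc_le_supnorm (\sum_(m <= i < n) frame_term X e i) t.
  rewrite C0_sumE; under eq_bigr do rewrite frame_termE.
  rewrite -rmorph_sum normc_real ger0_norm //.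
  by apply: sumr_ge0 => i _; exact: sqr_ge0.
apply: (@le_trans _ _ ((S + supnorm y ^+ 2 *
    \sum_(m <= i < n) (normc (e t) * normc (X i t)) ^+ 2) / 2)); last first.
  by rewrite ler_pM2r // lerD2l ler_wpM2l ?sqr_ge0.
rewrite mulr_sumr -big_split mulr_suml; apply: ler_sum => i _ /=.
rewrite ler_pdivlMr // -exprMn -subr_ge0.
set p := normc (c i); set q := supnorm y * _.
by rewrite (_ : _ - _ = (p - q) ^+ 2) ?sqr_ge0 //; ring.
Qed.

(** The Cauchy criterion for the one series attached to [e]. *)
Lemma frame_tail_small (e : A) (eps : R) :
    cvgn (series (frame_term X e)) -> 0 < eps ->
  exists N, forall m n, (N <= m)%N -> (N <= n)%N ->
    supnorm (\sum_(m <= i < n) frame_term X e i) < eps.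
Proof.
move=> cvgX eps0; have epsC0 : 0 < eps%:C :> R[i] by rewrite ltcR.
have cauchyX : cauchy (series (frame_term X e) @ \oo).
  exact: cvg_cauchy cvgX.
have [[P Q] /= [[a _ aP] [b _ bQ]] PQ] :=
  (cauchy_seriesP (frame_term X e)).1 cauchyX _ epsC0.
exists (maxn a b) => m n; rewrite !geq_max => /andP[am _] /andP[_ bn].
have := PQ (m, n) (conj (aP _ am) (bQ _ bn)).
by rewrite /= -[`|_|]/((supnorm _)%:C) ltcR.
Qed.

End Tails.

(** * Total boundedness of the unit ball *)

Section UnitBall.
Variables (K : topologicalType) (R : realType).
Local Notation A := (C0 K R).
Variables (X : nat -> Cb K R) (Phi : nat -> {scalar A}).

Lemma C0_inner_lB (x y : A) (b : Cb K R) :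
  C0_inner_l (x - y) b = C0_inner_l x b - C0_inner_l y b.
Proof.
apply/val_inj/val_inj/funext => t.
by rewrite -[LHS]/((x t - y t)^* * b t) rmorphB mulrBl.
Qed.

Lemma unit_ball_coordinates_net (N : nat) (r : R) :
    (forall i, `|X i| <= 1) -> (forall k, functional_norm (Phi k) = 1%E) ->
    0 < r ->
  exists F : set A, [/\ finite_set F, F `<=` unit_ball K R &
    forall y, unit_ball K R y -> exists2 z, F z &
      forall k i, (k < N)%N -> (i < N)%N ->
        normc (Phi k (C0_inner_l (z - y) (X i))) ^+ 2 <= r].
Proof.
move=> X1 Phi1 r0.
pose coord (j : 'I_N * 'I_N) (x : A) := Phi j.1 (C0_inner_l x (X j.2)).
pose g (j : 'I_N * 'I_N * bool) (x : A) :=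
  if j.2 then complex.Re (coord j.1 x) else complex.Im (coord j.1 x).
have g1 j x : unit_ball K R x -> `|g j x| <= 1.
  move=> /unit_ballP x1; have coord1 : normc (coord j.1 x) <= 1.
    apply: le_trans (functional_norm1_le _ (Phi1 _)) (supnorm_le _ _) => // t.
    rewrite /= normcM normc_conj mulr_ile1 ?normc_ge0 //.
    apply: le_trans (normc_le_supnorm _ _) _.
    by have := X1 j.1.2; rewrite -[`|_|]/((supnorm _)%:C) lecR.
  rewrite /g; case: j.2; apply: le_trans coord1; case: (coord _ _) => a b /=;
    by rewrite -sqrtr_sqr ler_wsqrtr // ?lerDl ?lerDr sqr_ge0.
(* With mesh d <= 1 the squared modulus is at most 2 d^2 <= 2 d <= r. *)
pose d := Num.min 1 (r / 2).
have d0 : 0 < d by rewrite lt_min ltr01 divr_gt0.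
have d2r : 2 * d ^+ 2 <= r.
  have d1 : d <= 1 by rewrite ge_min lexx.
  have dr : d <= r / 2 by rewrite ge_min lexx orbT.
  have : d ^+ 2 <= d by rewrite expr2 ger_pMr.
  lra.
have ball0 : unit_ball K R !=set0.
  by exists 0; apply/unit_ballP => t; rewrite (_ : Cb_fun _ t = 0) ?normc0.
have [F [finF FY Fnet]] := finite_net d0 ball0 g1.
exists F; split=> // y /Fnet[z Fz zy]; exists z => // k i kN iN.
apply: le_trans d2r; pose j := (Ordinal kN, Ordinal iN).
have -> : Phi k (C0_inner_l (z - y) (X i)) = coord j z - coord j y.
  by rewrite C0_inner_lB linearB.
by apply: ler_normc_sqr; rewrite raddfB distrC;
  [exact: zy (j, true) | exact: zy (j, false)].
Qed.

Lemma unit_ball_totally_bounded :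
    locally_compact [set: K] -> hausdorff_space K ->
    countable_compacts_bounded K ->
    admissible_system X -> (forall k, is_state (Phi k)) ->
  nu_totally_bounded X Phi (unit_ball K R).
Proof.
move=> lcK hdK ccK [cvgX _ X1] PhiS d d0.
have Phi1 k : functional_norm (Phi k) = 1%E by have [] := PhiS k.
have [B cB PhiB] := states_carried_by_compact ccK Phi1.
have [e eB] := C0_urysohn R lcK hdK cB.
(* Each sum is cut at N into two pieces, each of which will be at most q. *)
pose q := d ^+ 2 / 4.
have q0 : 0 < q by rewrite divr_gt0 // exprn_gt0.
have qd : 2 * q < d ^+ 2 by rewrite /q; have := exprn_gt0 2 d0; lra.
(* Differences of points of the unit ball have norm at most 2, whence 4. *)
have [N tailN] := frame_tail_small (cvgX e) (divr_gt0 q0 (ltr0n R 4)).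
have tail (x : A) k m n :
    (forall t, normc (x t) <= 2) -> (N <= m)%N -> (N <= n)%N ->
    \sum_(m <= i < n) normc (Phi k (C0_inner_l x (X i))) ^+ 2 <= q.
  move=> x2 Nm Nn.
  apply: le_trans (carried_tail_le X x _ _ (Phi1 k) (PhiB k) eB) _.
  have := tailN _ _ Nm Nn; set D := supnorm _ => Dq.
  have D0 : 0 <= D by exact: supnorm_ge0.
  have xx : supnorm x ^+ 2 <= 4.
    rewrite -[4](_ : 2 ^+ 2 = _) ?ler_sqr ?nnegrE ?supnorm_ge0 //; last by ring.
    exact: supnorm_le.
  have : supnorm x ^+ 2 * D <= 4 * D by rewrite ler_wpM2r.
  lra.
have qN0 : 0 < q / N.+1%:R by rewrite divr_gt0.
have [F [finF FY Fnet]] := unit_ball_coordinates_net N X1 Phi1 qN0.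
exists F; split=> // y Yy; have [z Fz zy] := Fnet y Yy.
exists z => //; split=> //.
have zy2 t : normc ((z - y) t) <= 2.
  have /unit_ballP/(_ t) zt := FY _ Fz; have /unit_ballP/(_ t) yt := Yy.
  rewrite -[(z - y) t]/(z t - y t); apply: le_trans (le_normcD _ _) _.
  by rewrite normcN; lra.
(* A nonempty sum from k to n <= N forces k < N, so that the net controls it. *)
have head k n : (n <= N)%N ->
    \sum_(k <= i < n) normc (Phi k (C0_inner_l (z - y) (X i))) ^+ 2 <= q.
  move=> nN; apply: (@le_trans _ _ (\sum_(k <= i < n) q / N.+1%:R)).
    apply: ler_sum_nat => i /andP[ki iN].
    by apply: zy; [apply: leq_ltn_trans ki _|]; exact: leq_trans iN nN.
  rewrite sumr_const_nat -[leLHS]mulr_natr mulrAC ler_pdivrMr //.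
  rewrite ler_pM2l // ler_nat (leq_trans (leq_subr _ _)) //.
  exact: leq_trans nN (leqnSn N).
have sum_le k n :
    \sum_(k <= i < n) normc (Phi k (C0_inner_l (z - y) (X i))) ^+ 2 <= 2 * q.
  have [nN|/ltnW Nn] := leqP n N; first by have := head k n nN; lra.
  have [Nk|/ltnW kN] := leqP N k; first by have := tail _ k k n zy2 Nk Nn; lra.
  rewrite (big_cat_nat kN Nn) /=.
  by have := head k N (leqnn N); have := tail _ k N n zy2 (leqnn N) Nn; lra.
have nu_le : (nu_sqr X Phi (z - y)%R <= (2 * q)%:E)%E.
  apply: ge_ereal_sup => _ [k _ <-]; apply: lime_le.
    by apply: is_cvg_nneseries => n _ _; rewrite lee_fin sqr_ge0.
  by apply: nearW => n; rewrite sumEFin lee_fin.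
apply: (@le_lt_trans _ _ (sqrte (2 * q)%:E)).
  by rewrite lee_sqrt // lee_fin mulr_ge0 // ltW.
by rewrite lte_fin -[ltRHS]ger0_norm ?ltW // -sqrtr_sqr ltr_sqrt ?exprn_gt0.
Qed.

End UnitBall.

Theorem mainTheorem1 (R : realType) (K : topologicalType)
    (lcK : locally_compact [set: K]) (hdK : hausdorff_space K)
    (nscK : ~ sigma_compact K) (ccK : countable_compacts_bounded K) :
  outer_totally_bounded (unit_ball K R) /\
  outer_totally_bounded ((idfun : C0 K R -> C0 K R) @` unit_ball K R).
Proof.
rewrite image_id; split=> X Phi admX statePhi;
  exact: unit_ball_totally_bounded.
Qed.
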